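(* Let $n\ge 1$, let $B_1,\dots,B_k$ be boolean combinations of event symbols $A_1,\dots,A_n$, let $R$ be an index set of arbitrary cardinality, and for each $r\in R$ let $g_r$ be a real-valued function of $k$ real variables (defined at least on $[0,1]^k$) and let $\triangleleft_r\in\{=,\neq,\ge\}$. For $\alpha\in\Sigma=\{-1,1\}^n$ put $A^{\alpha}=\bigcap_{i=1}^n A_i^{\alpha_i}$, where $A_i^{1}=A_i$ and $A_i^{-1}=A_i^c$, and for each $j$ let $\Sigma_j\subseteq\Sigma$ be the set for which $B_j=\bigcup_{\alpha\in\Sigma_j}A^{\alpha}$ (disjunctive normal form). For $\mathbf y=(y_\alpha)_{\alpha\in\Sigma}\in\mathbb R^{\Sigma}$ put $x_j(\mathbf y)=\sum_{\alpha\in\Sigma_j}y_\alpha$. Then the family of requirements $g_r(P(B_1),\dots,P(B_k))\triangleleft_r 0$, $r\in R$, together with the requirement that all finite collections of events are jointly perceivable, is semantically consistent (i.e. determines a probability environment) if and only if the system $$g_r(x_1(\mathbf y),\dots,x_k(\mathbf y))\triangleleft_r 0\ \ (r\in R),\qquad \sum_{\alpha\in\{-1,1\}^n}y_\alpha=1,\qquad y_\alpha\ge 0\ \ (\alpha\in\{-1,1\}^n)$$ admits a real solution $\mathbf y=(y_\alpha)_{\alpha\in\Sigma}$.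
   Context: A basic probability space is a triple $(\overline\Omega,\overline{\mathbb A},\overline P)$ where $\overline\Omega$ is a set, $\overline{\mathbb A}$ is a family of subsets of $\overline\Omega$ containing $\emptyset$ and $\overline\Omega$, and $\overline P:\overline{\mathbb A}\to\mathbb R$ satisfies $\overline P(\emptyset)=0$, $\overline P(\overline\Omega)=1$, and $\overline P(\overline A)\le\overline P(\overline B)$ whenever $\overline A\subseteq\overline B$ are in $\overline{\mathbb A}$. A collection of events is jointly perceivable if $\overline P$ is countably additive on the $\sigma$-algebra it generates. For finitely many events this $\sigma$-algebra is a finite algebra, so the requirement that all finite collections of events are jointly perceivable means that $\overline{\mathbb A}$ is an algebra of sets and $\overline P$ is finitely additive on it. A family of requirements as in the claim is semantically consistent (determines a probability environment) if there is a basic probability space $(\overline\Omega,\overline{\mathbb A},\overline P)$ in which all finite collections of events are jointly perceivable, and events $\overline A_1,\dots,\overline A_n\in\overline{\mathbb A}$, such that, with $\overline B_j$ the boolean combination $B_j$ evaluated at $\overline A_1,\dots,\overline A_n$, one has $g_r(\overline P(\overline B_1),\dots,\overline P(\overline B_k))\triangleleft_r 0$ for all $r\in R$. *)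

(* Defs.v *)
From HB Require Import structures.
From mathcomp Require Import all_boot all_order all_algebra.
From mathcomp Require Import all_classical all_reals all_analysis.

Set Implicit Arguments.
Unset Strict Implicit.
Unset Printing Implicit Defensive.

Import Order.TTheory GRing.Theory Num.Theory.
Import numFieldNormedType.Exports.

Local Open Scope classical_set_scope.
Local Open Scope ring_scope.

(* The probability is only meaningful on [event]: it is a total function whose
   values on other sets are unconstrained. *)
Record basic_prob_space (R : realType) := BasicProbSpace {
  outcome :> Type;
  event : set (set outcome);
  prob : set outcome -> R;
  event0 : event set0;
  eventT : event setT;
  prob0 : prob set0 = 0;
  probT : prob setT = 1;
  le_prob : forall A B, event A -> event B -> A `<=` B -> prob A <= prob B
}.

(* The first conjunct says that the probability is defined on <<s G>>. *)
Definition jointly_perceivable (R : realType) (S : basic_prob_space R)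
    (G : set (set S)) : Prop :=
  <<s G>> `<=` @event R S /\
  forall F : nat -> set S, (forall i, <<s G>> (F i)) -> trivIset setT F ->
    (fun m => \sum_(0 <= i < m) prob (F i)) @ \oo --> prob (\bigcup_i F i).

Definition finitely_perceivable (R : realType) (S : basic_prob_space R) : Prop :=
  forall G : set (set S), finite_set G -> G `<=` @event R S ->
    jointly_perceivable G.

Inductive boolcomb (n : nat) : Type :=
| BSym of 'I_n
| BCompl of boolcomb n
| BInter of boolcomb n & boolcomb n
| BUnion of boolcomb n & boolcomb n.

Fixpoint beval (n : nat) (T : Type) (A : 'I_n -> set T) (b : boolcomb n) : set T :=
  match b with
  | BSym i => A i
  | BCompl b1 => ~` beval A b1
  | BInter b1 b2 => beval A b1 `&` beval A b2
  | BUnion b1 b2 => beval A b1 `|` beval A b2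
  end.

(* {-1,1}^n, with [true] standing for 1 and [false] for -1. *)
Notation signs n := {ffun 'I_n -> bool}.

Definition atom (n : nat) (T : Type) (A : 'I_n -> set T) (alpha : signs n) : set T :=
  \bigcap_(i in [set: 'I_n]) (if alpha i then A i else ~` A i).

(* The event symbols are formal, so the disjunctive normal form is an identity
   between boolean combinations: it holds under every interpretation. *)
Definition is_dnf (n : nat) (b : boolcomb n) (S : {set signs n}) : Prop :=
  forall (T : Type) (A : 'I_n -> set T),
    beval A b = \bigcup_(alpha in [set alpha | alpha \in S]) atom A alpha.

Lemma dnf_exists_unique (n : nat) (b : boolcomb n) : exists! S, is_dnf b S.
Proof.
pose V (i : 'I_n) : set (signs n) := [set alpha : signs n | alpha i].
have atomV alpha beta : atom V alpha beta <-> beta = alpha.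
  split=> [h|-> i _]; last by rewrite /V; case: ifP => //= ->.
  by apply/ffunP => i; have := h i I; rewrite /V; case: (alpha i) => //= /negP/negbTE.
exists [set alpha : signs n | `[< beval V b alpha >]]%SET; split.
  move=> T A; apply/seteqP.
  pose sg w : signs n := [ffun i => `[< A i w >]].
  have atomA alpha w : atom A alpha w <-> alpha = sg w.
    split=> [h|-> i _].
      apply/ffunP => i; have := h i I; rewrite ffunE.
      by case: (alpha i) => h'; [rewrite asboolT | rewrite asboolF].
    by rewrite ffunE; case: asboolP.
  have evalE w : beval A b w <-> beval V b (sg w).
    elim: b => /= [i|b1 IH|b1 IH1 b2 IH2|b1 IH1 b2 IH2].
    - by rewrite /V /= ffunE; split=> [/asboolP|/asboolP].
    - by rewrite /setC /= IH.
    - by rewrite /setI /= IH1 IH2.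
    - by rewrite /setU /= IH1 IH2.
  split=> w.
    move=> /evalE h; exists (sg w); last exact/atomA.
    by rewrite /= inE; apply/asboolP.
  by case=> alpha; rewrite /= inE => /asboolP h /atomA e; apply/evalE; rewrite -e.
move=> S hS; apply/setP => alpha; rewrite inE; apply/asboolP/idP; rewrite hS.
  by case=> beta /= hb /atomV ->.
by move=> h; exists alpha => //; apply/atomV.
Qed.

Inductive req_rel := ReqEq | ReqNeq | ReqGe.

Definition req_holds (R : realType) (c : req_rel) (x : R) : Prop :=
  match c with
  | ReqEq => x = 0
  | ReqNeq => x <> 0
  | ReqGe => 0 <= x
  end.

Definition semantically_consistent (R : realType) (n k : nat)
    (B : 'I_k -> boolcomb n) (I : Type) (g : I -> 'rV[R]_k -> R)
    (c : I -> req_rel) : Prop :=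
  exists (S : basic_prob_space R) (A : 'I_n -> set S),
    [/\ finitely_perceivable S,
        forall i, @event R S (A i) &
        forall r, req_holds (c r) (g r (\row_j prob (beval A (B j))))].

(* Main.v *)
Require Import Defs.
From mathcomp Require Import all_boot all_order all_algebra.
From mathcomp Require Import all_classical all_reals all_analysis.

Set Implicit Arguments.
Unset Strict Implicit.
Unset Printing Implicit Defensive.

Import Order.TTheory GRing.Theory Num.Theory.
Import numFieldNormedType.Exports.

Local Open Scope classical_set_scope.
Local Open Scope ring_scope.

(* Given a model, put y_alpha = P(A^alpha). The atoms are pairwise disjoint,
   cover the space and lie in the sigma-algebra generated by the A_i, on which P
   is additive, so P(B_j) is the sum of the y_alpha over Sigma_j.
   Conversely, a solution y is a probability mass function on the finite set
   {-1,1}^n; interpreting A_i as { alpha | alpha_i = 1 } makes the atom A^alpha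
   the singleton {alpha}, so again P(B_j) = x_j(y). *)

Lemma sigma_algebra_countType_bigcup (T : Type) (G : set (set T))
    (J : countType) (F : J -> set T) :
  (forall j, <<s G>> (F j)) -> <<s G>> (\bigcup_j F j).
Proof.
move=> mF.
have -> : \bigcup_j F j = \bigcup_i oapp F set0 (unpickle i).
  apply/seteqP; split=> x [i _].
    by move=> Fx; exists (pickle i) => //; rewrite pickleK.
  by case: unpickle => //= j Fx; exists j.
apply: sigma_algebra_bigcup => i.
by case: unpickle => [j|] /=; [exact: mF | exact: sigma_algebra0].
Qed.

(** By De Morgan, an atom is the complement of a union, over the countable type ['I_n], of sets
    [A i] or their complements. *)
Lemma sigma_algebra_atom (n : nat) (T : Type) (A : 'I_n -> set T)
    (alpha : signs n) : <<s range A>> (atom A alpha).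
Proof.
rewrite /atom -[X in <<s _>> X]setCK setC_bigcap -setTD.
apply: sigma_algebraCD; apply: sigma_algebra_countType_bigcup => i.
have mA : <<s range A>> (A i) by apply: sub_sigma_algebra; exists i.
case: ifP => _; last by rewrite setCK.
by rewrite -setTD; exact: sigma_algebraCD.
Qed.

(** Each outcome has a single sign vector; this yields both disjointness of the atoms and the fact
    that they cover the space. *)
Lemma atomP (n : nat) (T : Type) (A : 'I_n -> set T) (alpha : signs n) w :
  atom A alpha w <-> alpha = [ffun i => `[< A i w >]].
Proof.
split=> [h|-> i _]; last by rewrite ffunE; case: asboolP.
apply/ffunP => i; have := h i I; rewrite ffunE.
by case: (alpha i) => h'; [rewrite asboolT | rewrite asboolF].
Qed.

(** Countable additivity is applied to the finite family padded with empty sets: as [prob set0 = 0],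
    the partial sums are eventually constant. *)
Lemma prob_bigcup_fin (R : realType) (S : basic_prob_space R)
    (G : set (set S)) (J : finType) (F : J -> set S) (D : {set J}) :
  jointly_perceivable G -> (forall j, <<s G>> (F j)) -> trivIset setT F ->
  prob (\bigcup_(j in [set j | j \in D]) F j) = \sum_(j in D) prob (F j).
Proof.
move=> [_ sadd] mF tF.
pose s := [seq F j | j <- enum D].
have sz : size s = size (enum D) by rewrite size_map.
(* The default [set0] has no points, so a point at position [i] comes from some [j] in [D].
   Recording the index of [j] turns equality of labels into equality of positions, even if [F] is
   not injective. *)
have nthP i x : nth set0 s i x ->
    exists2 j, (j \in D /\ index j (enum D) = i) & F j x.
  have [ltis|leis] := ltnP i (size s); last by rewrite nth_default.
  have [j0 _] : exists j0 : J, true.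
    by move: ltis; rewrite sz; case: (enum D) => // j0 *; exists j0.
  rewrite (nth_map j0) -?sz// => Fx; exists (nth j0 (enum D) i) => //.
  rewrite sz in ltis; split; last by rewrite index_uniq ?enum_uniq.
  by rewrite -mem_enum mem_nth.
have ms i : <<s G>> (nth set0 s i).
  have [ltis|leis] := ltnP i (size s).
    by have /mapP[j _ ->] := mem_nth set0 ltis.
  by rewrite nth_default//; exact: sigma_algebra0.
have ts : trivIset setT (nth set0 s).
  move=> i i' _ _ [x [/nthP[j [_ <-] Fjx] /nthP[j' [_ <-] Fj'x]]].
  by rewrite (tF j j')//; exists x.
have eU : \bigcup_i nth set0 s i = \bigcup_(j in [set j | j \in D]) F j.
  apply/seteqP; split=> x [i].
    by move=> _ /nthP[j [jD _] Fx]; exists j.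
  move=> /= iD Fx; exists (index i (enum D)) => //.
  by rewrite /s (nth_map i) ?index_mem ?mem_enum// nth_index ?mem_enum.
have := sadd _ ms ts; rewrite eU => cvgU; apply: (cvg_unique _ cvgU) => //.
apply: cvg_near_cst; exists (size s) => // m /= lesm.
rewrite (@big_cat_nat _ _ _ (size s))//= [X in _ + X]big_nat [X in _ + X]big1 ?addr0; last first.
  by move=> i /andP[lesi _]; rewrite nth_default// prob0.
by rewrite -(big_nth set0 xpredT (@prob R S)) big_map big_enum.
Qed.

(** At most one [F i] contains [x], so the partial sums are constant once that index has been
    passed. *)
Lemma cvg_indic_trivIset (R : realType) (T : Type) (F : nat -> set T) (x : T) :
  trivIset setT F ->
  (fun m => \sum_(0 <= i < m) \1_(F i) x : R) @ \oo --> (\1_(\bigcup_i F i) x : R).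
Proof.
move=> tF; apply: cvg_near_cst.
have [[i _ Fix]|nFx] := pselect ((\bigcup_i F i) x).
  exists i.+1 => // m /= ltim.
  rewrite (bigD1_seq i) ?iota_uniq ?mem_index_iota//= big1 ?addr0.
    by rewrite !indicE !mem_set//; exists i.
  move=> j /eqP ji; rewrite indicE memNset// => Fjx; apply: ji.
  by apply: tF => //; exists x.
exists 0 => // m _; rewrite [RHS]indicE memNset// big1// => i _.
by rewrite indicE memNset// => Fix; apply: nFx; exists i.
Qed.

Section WeightedSpace.
Variables (R : realType) (J : finType) (y : J -> R).
Hypotheses (y_ge0 : forall j, 0 <= y j) (y_sum1 : \sum_j y j = 1).

(** With the indicator inside a sum over all of [J], additivity reduces to a statement about each
    point [j]. *)
Let weight (X : set J) : R := \sum_j y j * \1_X j.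

Let weight0 : weight set0 = 0.
Proof. by rewrite /weight big1// => j _; rewrite indic0 mulr0. Qed.

Let weightT : weight setT = 1.
Proof. by rewrite -y_sum1; apply: eq_bigr => j _; rewrite indicT mulr1. Qed.

Let le_weight X Y : setT X -> setT Y -> X `<=` Y -> weight X <= weight Y.
Proof.
move=> _ _ XY; apply: ler_sum => j _; apply: ler_wpM2l => //.
rewrite !indicE ler_nat; case: (boolP (j \in X)) => // /set_mem /XY Yj.
by rewrite mem_set.
Qed.

Definition weighted_space : basic_prob_space R :=
  @BasicProbSpace R J setT weight I I weight0 weightT le_weight.

Lemma weighted_space_finitely_perceivable :
  finitely_perceivable weighted_space.
Proof.
move=> G _ _; split=> // F _ tF.
(* Exchanging the sums leaves a finite sum over [J] of convergent sequences, so limits can be taken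
   termwise. *)
have -> : (fun m => \sum_(0 <= i < m) @prob _ weighted_space (F i)) =
    (fun m => \sum_j y j * \sum_(0 <= i < m) \1_(F i) j).
  apply/funext => m; rewrite exchange_big; apply: eq_bigr => j _.
  by rewrite mulr_sumr.
apply: cvg_big => [|j _]; first exact: add_continuous.
by apply: cvgM; [exact: cvg_cst | exact: cvg_indic_trivIset].
Qed.

Lemma prob_weighted_space (D : {set J}) :
  @prob _ weighted_space [set j | j \in D] = \sum_(j in D) y j.
Proof.
rewrite [RHS]big_mkcond; apply: eq_bigr => j _.
by rewrite indicE/= mem_setE; case: ifP; rewrite ?mulr1 ?mulr0.
Qed.

End WeightedSpace.

Theorem lemma3p1 (R : realType) (n k : nat) (hn : (1 <= n)%N)
    (B : 'I_k -> boolcomb n)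
    (I : Type) (g : I -> 'rV[R]_k -> R) (c : I -> req_rel)
    (Sigma : 'I_k -> {set signs n}) (hSigma : forall j, is_dnf (B j) (Sigma j)) :
  semantically_consistent B g c <->
  exists y : {ffun signs n -> R},
    [/\ forall r, req_holds (c r) (g r (\row_j \sum_(alpha in Sigma j) y alpha)),
        \sum_alpha y alpha = 1 &
        forall alpha, 0 <= y alpha].
Proof.
split=> [[S [A [fin_perc evA req]]] | [y [req y_sum1 y_ge0]]].
  have perc : jointly_perceivable (range A).
    by apply: fin_perc; [exact: finite_image | move=> _ [i _ <-]].
  have tA : trivIset setT (atom A).
    by move=> alpha beta _ _ [w [/atomP -> /atomP ->]].
  have prob_atoms (D : {set signs n}) :
      prob (\bigcup_(alpha in [set alpha | alpha \in D]) atom A alpha) =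
      \sum_(alpha in D) prob (atom A alpha).
    by apply: (prob_bigcup_fin D perc) => // alpha; exact: sigma_algebra_atom.
  exists [ffun alpha => prob (atom A alpha)]; split.
  - move=> r; have := req r; congr (req_holds _ (g r _)).
    apply/rowP => j; rewrite !mxE hSigma prob_atoms.
    by apply: eq_bigr => alpha _; rewrite ffunE.
  - rewrite -(@probT _ S).
    have -> : [set: S] =
        \bigcup_(alpha in [set alpha | alpha \in [set: signs n]%SET]) atom A alpha.
      apply/seteqP; split=> // w _; exists [ffun i => `[< A i w >]].
        by rewrite /= finset.in_setT.
      exact/atomP.
    rewrite prob_atoms; apply: eq_big => alpha; first by rewrite finset.in_setT.
    by rewrite ffunE.
  (* Nonnegativity is monotonicity from [set0]; that the atom is an event is the first half of joint
     perceivability. *)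
  - move=> alpha; rewrite ffunE -(@prob0 _ S); apply: le_prob => //.
      exact: event0.
    by apply: (proj1 perc); exact: sigma_algebra_atom.
exists (weighted_space y_ge0 y_sum1).
pose V (i : 'I_n) := [set alpha : signs n | alpha i].
exists V; split=> // [|r]; first exact: weighted_space_finitely_perceivable.
have := req r; congr (req_holds _ (g r _)); apply/rowP => j; rewrite !mxE.
rewrite hSigma -prob_weighted_space; congr prob.
(* In this model an outcome is its own sign vector. *)
have atomV alpha beta : atom V alpha beta <-> alpha = beta.
  rewrite atomP; suff -> : [ffun i => `[< V i beta >]] = beta by [].
  by apply/ffunP => i; rewrite ffunE asboolb.
apply/seteqP; split=> alpha.
  by move=> /= alphaS; exists alpha => //; exact/atomV.
by case=> beta /= betaS /atomV <-.
Qed.
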